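(* Let $b>0$, $\lambda\in(0,1)$ and let $\eta:(0,\infty)\times(0,2]\to(0,1]$ be a mapping that decreases with $r$ for fixed $\varepsilon$ (i.e. $\eta(r,\varepsilon)$ is nonincreasing in its first argument). Then for all $UCW$-hyperbolic spaces $(X,d,W,\eta)$, all nonempty subsets $C\subseteq X$, all $\lambda$-firmly nonexpansive mappings $T:C\to C$ and all $x\in C$ such that $T$ has approximate fixed points in a $b$-neighborhood of $x$, the following holds: $$\forall\varepsilon>0\ \forall n\ge\Phi(\varepsilon,\eta,\lambda,b)\quad d(T^nx,T^{n+1}x)\le\varepsilon,$$ where $n$ ranges over the natural numbers and $$\Phi(\varepsilon,\eta,\lambda,b):=\begin{cases}\left[\dfrac{b+1}{\varepsilon\,\lambda(1-\lambda)\,\eta\left(b+1,\frac{\varepsilon}{b+1}\right)}\right]&\text{for }\varepsilon<2b,\\[2mm]0&\text{otherwise},\end{cases}$$ with $[\cdot]$ denoting the integer part.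
   Context: A $W$-hyperbolic space $(X,d,W)$ is a metric space $(X,d)$ together with a map $W:X\times X\times[0,1]\to X$ (a convexity mapping) such that for all $x,y,z,w\in X$ and $\lambda,\tilde\lambda\in[0,1]$: (W1) $d(z,W(x,y,\lambda))\le(1-\lambda)d(z,x)+\lambda d(z,y)$; (W2) $d(W(x,y,\lambda),W(x,y,\tilde\lambda))=|\lambda-\tilde\lambda|\,d(x,y)$; (W3) $W(x,y,\lambda)=W(y,x,1-\lambda)$; (W4) $d(W(x,z,\lambda),W(y,w,\lambda))\le(1-\lambda)d(x,y)+\lambda d(z,w)$. One writes $(1-\lambda)x\oplus\lambda y:=W(x,y,\lambda)$. A modulus of uniform convexity for $(X,d,W)$ is a map $\eta:(0,\infty)\times(0,2]\to(0,1]$ such that for all $r>0$, $\varepsilon\in(0,2]$ and $a,x,y\in X$: if $d(x,a)\le r$, $d(y,a)\le r$ and $d(x,y)\ge\varepsilon r$, then $d(\frac12x\oplus\frac12y,a)\le(1-\eta(r,\varepsilon))r$. It is monotone if it decreases (is nonincreasing) in $r$ for each fixed $\varepsilon$. A $UCW$-hyperbolic space $(X,d,W,\eta)$ is a $W$-hyperbolic space $(X,d,W)$ having $\eta$ as a monotone modulus of uniform convexity. For $C\subseteq X$ and $\lambda\in(0,1)$, a map $T:C\to X$ is $\lambda$-firmly nonexpansive if $d(Tx,Ty)\le d((1-\lambda)x\oplus\lambda Tx,(1-\lambda)y\oplus\lambda Ty)$ for all $x,y\in C$. $T:C\to C$ has approximate fixed points in a $b$-neighborhood of $x\in C$ if for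 every $\varepsilon>0$ there is $y\in C$ with $d(y,x)\le b$ and $d(y,Ty)<\varepsilon$. *)

(* Defs.v *)
From mathcomp Require Import all_boot all_order all_algebra.
From mathcomp Require Import classical_sets functions reals topology.

Set Implicit Arguments.
Unset Strict Implicit.
Unset Printing Implicit Defensive.

Import Order.TTheory GRing.Theory Num.Theory.
Local Open Scope classical_set_scope.
Local Open Scope ring_scope.

(* [W x y l] stands for (1 - l) x (+) l y. The convexity mapping is a total
   function of its real parameter, but it is constrained and used only for
   parameters in [0, 1]. *)
Record w_hyperbolic (R : realType) (X : metricType R)
    (W : X -> X -> R -> X) : Prop := WHyperbolic {
  W1 : forall x y z l, 0 <= l <= 1 ->
    mdist z (W x y l) <= (1 - l) * mdist z x + l * mdist z y ;
  W2 : forall x y l l', 0 <= l <= 1 -> 0 <= l' <= 1 ->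
    mdist (W x y l) (W x y l') = `|l - l'| * mdist x y ;
  W3 : forall x y l, 0 <= l <= 1 -> W x y l = W y x (1 - l) ;
  W4 : forall x y z w l, 0 <= l <= 1 ->
    mdist (W x z l) (W y w l) <= (1 - l) * mdist x y + l * mdist z w }.

(* A map from ]0, +oo[ * ]0, 2] to ]0, 1] is represented by a total function
   R -> R -> R, of which only the values on that domain are relevant. *)
Definition modulus_map (R : realType) (eta : R -> R -> R) : Prop :=
  forall r e, 0 < r -> 0 < e <= 2 -> 0 < eta r e <= 1.

Definition monotone_modulus (R : realType) (eta : R -> R -> R) : Prop :=
  forall r s e, 0 < r -> r <= s -> 0 < e <= 2 -> eta s e <= eta r e.

Definition modulus_of_uniform_convexity (R : realType) (X : metricType R)
    (W : X -> X -> R -> X) (eta : R -> R -> R) : Prop :=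
  modulus_map eta /\
  forall r e, 0 < r -> 0 < e <= 2 ->
  forall a x y : X,
    mdist x a <= r -> mdist y a <= r -> e * r <= mdist x y ->
    mdist (W x y 2^-1) a <= (1 - eta r e) * r.

Record ucw_hyperbolic (R : realType) (X : metricType R)
    (W : X -> X -> R -> X) (eta : R -> R -> R) : Prop := UCWHyperbolic {
  ucw_w_hyperbolic : w_hyperbolic W ;
  ucw_modulus : modulus_of_uniform_convexity W eta ;
  ucw_monotone : monotone_modulus eta }.

(* A map defined on a subset [C] of [X] is represented by a total function on
   [X], of which only the values on [C] are relevant. *)
Definition firmly_nonexpansive (R : realType) (X : metricType R)
    (W : X -> X -> R -> X) (C : set X) (l : R) (T : X -> X) : Prop :=
  forall x y, C x -> C y ->
    mdist (T x) (T y) <= mdist (W x (T x) l) (W y (T y) l).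

Definition approx_fixed_points_near (R : realType) (X : metricType R)
    (C : set X) (T : X -> X) (b : R) (x : X) : Prop :=
  forall e, 0 < e ->
    exists y, [/\ C y, mdist y x <= b & mdist y (T y) < e].

Definition Phi (R : realType) (eps : R) (eta : R -> R -> R) (l b : R) : nat :=
  if eps < 2 * b then
    Num.truncn ((b + 1) / (eps * l * (1 - l) * eta (b + 1) (eps / (b + 1))))
  else 0%N.

(* Main.v *)
(** The orbit approaches a point [y] with [d(y, Ty)] small. Firm nonexpansivity
    gives [d(Tz, y) <= d((1-l) z (+) l Tz, y) + (1+l) d(y, Ty)], and uniform
    convexity bounds the right-hand side by about [d(z, y) - l(1-l) eta eps]
    as long as [d(z, Tz) > eps]. The displacements [d(T^i x, T^i+1 x)] are
    nonincreasing, so if the [n]-th one exceeds [eps] then [d(T^i x, y)] loses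
    this amount at each of the first [n+1] steps, which starting from
    [d(x, y) <= b] makes it negative once [n >= Phi]. *)
Require Import Defs.
From mathcomp Require Import all_boot all_order all_algebra.
From mathcomp Require Import classical_sets functions reals topology.
From mathcomp Require Import ring lra.

Import Order.TTheory GRing.Theory Num.Theory.
Local Open Scope classical_set_scope.
Local Open Scope ring_scope.

Lemma w_hyperbolic_dist_left (R : realType) (X : metricType R)
    (W : X -> X -> R -> X) (hW : w_hyperbolic W) (x y : X) (l : R) :
  0 <= l <= 1 -> mdist x (W x y l) <= l * mdist x y.
Proof. by move=> hl; have := W1 hW x y x hl; rewrite mdistxx mulr0 add0r. Qed.

Lemma w_hyperbolic_dist_right (R : realType) (X : metricType R)
    (W : X -> X -> R -> X) (hW : w_hyperbolic W) (x y : X) (l : R) :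
  0 <= l <= 1 -> mdist (W x y l) y <= (1 - l) * mdist x y.
Proof.
move=> hl; have := W1 hW x y y hl.
by rewrite mdistxx mulr0 addr0 (metric_sym y x) (metric_sym y).
Qed.

(* Otherwise the midpoint of [u] and [v] would be strictly closer to [x],
   without being farther from [y], against the triangle inequality. *)
Lemma ucw_hyperbolic_between_unique (R : realType) (X : metricType R)
    (W : X -> X -> R -> X) (eta : R -> R -> R) (hX : ucw_hyperbolic W eta)
    (x y u v : X) (l : R) :
  mdist x u <= l * mdist x y -> mdist u y <= (1 - l) * mdist x y ->
  mdist x v <= l * mdist x y -> mdist v y <= (1 - l) * mdist x y ->
  u = v.
Proof.
have [hW [eta_map uc] _] := hX; move=> xu uy xv vy.
apply/eqP/negPn; rewrite -mdist_gt0; apply/negP => uv_gt0.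
set r := l * mdist x y in xu xv.
have uv_le : mdist u v <= mdist x u + mdist x v.
  by rewrite (metric_sym x u) metric_triangle.
have r_gt0 : 0 < r by lra.
have e_gt0 : 0 < mdist u v / r by rewrite divr_gt0.
have e_le2 : mdist u v / r <= 2 by rewrite ler_pdivrMr //; lra.
have he : 0 < mdist u v / r <= 2 by rewrite e_gt0.
have half01 : 0 <= (2^-1 : R) <= 1 by lra.
have xm : mdist (W u v 2^-1) x <= (1 - eta r (mdist u v / r)) * r.
  apply: uc => //; rewrite ?[mdist _ x]metric_sym //.
  by rewrite divfK // gt_eqF.
have my := W1 hW u v y half01.
rewrite [mdist y u]metric_sym [mdist y v]metric_sym in my.
have xy := metric_triangle x (W u v 2^-1) y.
rewrite [mdist x (W _ _ _)]metric_sym [mdist (W _ _ _) y]metric_sym in xy.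
have /andP[eta_gt0 _] := eta_map _ _ r_gt0 he.
have : 0 < eta r (mdist u v / r) * r by rewrite mulr_gt0.
have : r + (1 - l) * mdist x y = mdist x y by rewrite /r; ring.
lra.
Qed.

(** By [ucw_hyperbolic_between_unique], [W x y l] is the point at parameter [2 * l] between [x] and
    the midpoint of [x] and [y]. Uniform convexity brings the midpoint closer to [a], and [W1]
    passes on the fraction [2 * l] of this gain. *)
Lemma ucw_hyperbolic_convex_half (R : realType) (X : metricType R)
    (W : X -> X -> R -> X) (eta : R -> R -> R) (hX : ucw_hyperbolic W eta)
    (a x y : X) (l r e : R) :
  0 <= l <= 2^-1 -> 0 < r -> 0 < e <= 2 ->
  mdist x a <= r -> mdist y a <= r -> e * r <= mdist x y ->
  mdist (W x y l) a <= (1 - 2 * l * eta r e) * r.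
Proof.
have [hW [eta_map uc] _] := hX; move=> hl r_gt0 he xa ya xy.
have l01 : 0 <= l <= 1 by lra.
have ll01 : 0 <= 2 * l <= 1 by lra.
have half01 : 0 <= (2^-1 : R) <= 1 by lra.
have -> : W x y l = W x (W x y 2^-1) (2 * l).
  apply: (ucw_hyperbolic_between_unique _ _ _ _ hX x y _ _ l).
  - exact: w_hyperbolic_dist_left.
  - exact: w_hyperbolic_dist_right.
  - apply: le_trans (w_hyperbolic_dist_left _ _ _ hW x _ _ ll01) _.
    have -> : l * mdist x y = 2 * l * (2^-1 * mdist x y) by field.
    by apply: ler_wpM2l; [lra | exact: w_hyperbolic_dist_left].
  - rewrite metric_sym; apply: le_trans (W1 hW _ _ y ll01) _.
    have := w_hyperbolic_dist_right _ _ _ hW x y _ half01.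
    rewrite (metric_sym y x) (metric_sym y (W _ _ _)) => my.
    have : 2 * l * mdist (W x y 2^-1) y <= 2 * l * ((1 - 2^-1) * mdist x y).
      by apply: ler_wpM2l => //; lra.
    lra.
have := W1 hW x (W x y 2^-1) a ll01.
rewrite metric_sym (metric_sym a x) (metric_sym a (W _ _ _)).
have : 2 * l * mdist (W x y 2^-1) a <= 2 * l * ((1 - eta r e) * r).
  by apply: ler_wpM2l; [lra | exact: uc].
have : (1 - 2 * l) * mdist x a <= (1 - 2 * l) * r by apply: ler_wpM2l; lra.
lra.
Qed.

(** [W3] exchanges the endpoints when [l > 1/2]; the product [l * (1 - l)] is at most both [l] and
    [1 - l], so it serves on either half. *)
Lemma ucw_hyperbolic_convex (R : realType) (X : metricType R)
    (W : X -> X -> R -> X) (eta : R -> R -> R) (hX : ucw_hyperbolic W eta)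
    (a x y : X) (l r e : R) :
  0 <= l <= 1 -> 0 < r -> 0 < e <= 2 ->
  mdist x a <= r -> mdist y a <= r -> e * r <= mdist x y ->
  mdist (W x y l) a <= (1 - 2 * l * (1 - l) * eta r e) * r.
Proof.
have [hW [eta_map _] _] := hX; move=> hl r_gt0 he xa ya xy.
have /andP[eta_gt0 _] := eta_map _ _ r_gt0 he.
have er_gt0 : 0 < eta r e * r by rewrite mulr_gt0.
have l2er_ge0 : 0 <= l * l * (eta r e * r).
  by rewrite -expr2; apply: mulr_ge0; [exact: sqr_ge0 | exact: ltW].
have m2er_ge0 : 0 <= (1 - l) * (1 - l) * (eta r e * r).
  by rewrite -expr2; apply: mulr_ge0; [exact: sqr_ge0 | exact: ltW].
have [l_le|l_gt] := leP l 2^-1.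
  have hl' : 0 <= l <= 2^-1 by lra.
  have := ucw_hyperbolic_convex_half _ _ _ _ hX a x y l r e
    hl' r_gt0 he xa ya xy.
  lra.
have hl' : 0 <= 1 - l <= 2^-1 by lra.
rewrite metric_sym in xy; rewrite (W3 hW) //.
have := ucw_hyperbolic_convex_half _ _ _ _ hX a y x _ r e hl' r_gt0 he ya xa xy.
lra.
Qed.

(** [W4] bounds the firm estimate by [(1 - l) d(x, y) + l d(Tx, Ty)]; the last term is absorbed on
    the left and [1 - l > 0] cancelled. *)
Lemma firmly_nonexpansive_nonexpansive (R : realType) (X : metricType R)
    (W : X -> X -> R -> X) (hW : w_hyperbolic W) (C : set X) (l : R)
    (T : X -> X) :
  0 <= l < 1 -> firmly_nonexpansive W C l T ->
  forall x y, C x -> C y -> mdist (T x) (T y) <= mdist x y.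
Proof.
move=> hl hT x y Cx Cy.
have l01 : 0 <= l <= 1 by lra.
have hxy := le_trans (hT x y Cx Cy) (W4 hW x y (T x) (T y) l01).
have l1 : 0 < 1 - l by lra.
by rewrite -(ler_pM2l l1); lra.
Qed.

(** A single [s] can serve for a whole stretch of the orbit, which makes the loss per step
    independent of [z]. *)
Lemma firmly_nonexpansive_dist_decrease (R : realType) (X : metricType R)
    (W : X -> X -> R -> X) (eta : R -> R -> R) (hX : ucw_hyperbolic W eta)
    (C : set X) (l s eps delta : R) (T : X -> X) (y z : X) :
  0 <= l < 1 -> firmly_nonexpansive W C l T -> C y -> C z ->
  0 < delta -> mdist y (T y) <= delta -> mdist z y + delta <= s ->
  0 < eps -> eps <= 2 * s -> eps <= mdist z (T z) ->
  mdist (T z) y <= mdist z y + 3 * delta - eps * l * (1 - l) * eta s (eps / s).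
Proof.
have [hW [eta_map _] eta_mono] := hX.
move=> hl hT Cy Cz delta_gt0 yTy zs eps_gt0 eps_s eps_zTz.
have l01 : 0 <= l <= 1 by lra.
have zy_ge0 := mdist_ge0 z y.
(* The ball of radius [r] around [y] contains both [z] and [Tz], as
   [d(Tz, y) <= d(Tz, Ty) + delta]. *)
set r := mdist z y + delta in zs *.
have r_gt0 : 0 < r by rewrite /r; lra.
have s_gt0 : 0 < s by lra.
have he : 0 < eps / s <= 2 by rewrite divr_gt0 //= ler_pdivrMr.
have Tzy : mdist (T z) y <= r.
  apply: le_trans (metric_triangle _ (T y) _) _.
  rewrite (metric_sym (T y)); apply: lerD => //.
  exact: (firmly_nonexpansive_nonexpansive _ _ _ hW C l T hl hT).
have zTz_r : mdist z (T z) <= 2 * r.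
  have := metric_triangle z y (T z).
  by rewrite (metric_sym y (T z)) /r in Tzy *; lra.
have er : eps / s * r <= mdist z (T z).
  apply: le_trans eps_zTz.
  by rewrite mulrAC ler_pdivrMr // ler_wpM2l // ltW.
have zy : mdist z y <= r by rewrite /r; lra.
have uc := ucw_hyperbolic_convex _ _ _ _ hX y z (T z) l r _
  l01 r_gt0 he zy Tzy er.
(* One [delta] pays for replacing [Ty] by [y], the other for [W y (T y) l], which is within
   [l * delta] of [y]. *)
have Tzy_W : mdist (T z) y <= mdist (W z (T z) l) y + 2 * delta.
  have h1 := metric_triangle (T z) (T y) y.
  have h2 := hT z y Cz Cy.
  have h3 := metric_triangle (W z (T z) l) y (W y (T y) l).
  have h4 := w_hyperbolic_dist_left _ _ _ hW y (T y) l l01.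
  have : l * mdist y (T y) <= 1 * mdist y (T y).
    by apply: ler_wpM2r; [exact: mdist_ge0 | lra].
  by rewrite (metric_sym (T y)) in h1; lra.
have eta_le := eta_mono r s _ r_gt0 zs he.
have /andP[eta_gt0 _] := eta_map _ _ s_gt0 he.
(* The gain is freed from [r]: [eps <= d(z, Tz) <= 2 * r], and [eta] decreases in the radius. *)
have : l * (1 - l) * (eps * eta s (eps / s)) <=
    l * (1 - l) * (2 * r * eta r (eps / s)).
  by apply: ler_wpM2l; [apply: mulr_ge0; lra | apply: ler_pM; lra].
move: uc; rewrite /r; lra.
Qed.

Theorem theorem7p1 (R : realType) (b l : R) (eta : R -> R -> R)
  (b_gt0 : 0 < b) (l01 : 0 < l < 1)
  (eta_map : modulus_map eta) (eta_mono : monotone_modulus eta) :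
  forall (X : metricType R) (W : X -> X -> R -> X),
    ucw_hyperbolic W eta ->
  forall C : set X, C !=set0 ->
  forall T : X -> X, set_fun C C T -> firmly_nonexpansive W C l T ->
  forall x : X, C x -> approx_fixed_points_near C T b x ->
  forall eps : R, 0 < eps ->
  forall n : nat, (Phi eps eta l b <= n)%N ->
    mdist (iter n T x) (iter n.+1 T x) <= eps.
Proof.
move=> X W hX C _ T TC hT x Cx afp eps eps_gt0 n.
have [hW _ _] := hX.
have hl : 0 <= l < 1 by lra.
have ne := firmly_nonexpansive_nonexpansive _ _ _ hW C l T hl hT.
have Ci i : C (iter i T x) by elim: i => //= i; apply: TC.
have disp_mono i j : (i <= j)%N ->
    mdist (iter j T x) (iter j.+1 T x) <= mdist (iter i T x) (iter i.+1 T x).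
  move=> /subnK <-; elim: (j - i)%N => // k; apply: le_trans.
  by apply: ne; [exact: Ci | exact: (Ci (k + i).+1)].
rewrite /Phi; case: ltP => [eps_lt|eps_ge _]; last first.
  (* Here [2 * b <= eps], and already [d(x, Tx) <= 2 d(x, y) + d(y, Ty) <= 2 * b + d] for every
     [d > 0]. *)
  apply: le_trans (disp_mono 0%N n isT) _ => /=.
  apply/ler_addgt0Pr => d d_gt0; have [y [Cy yx yTy]] := afp d d_gt0.
  have h1 := metric_triangle x y (T x).
  have h2 := metric_triangle y (T y) (T x).
  have h3 := ne y x Cy Cx.
  by rewrite (metric_sym x y) in h1; lra.
set K := eps * l * (1 - l) * eta (b + 1) (eps / (b + 1)).
have b1_gt0 : 0 < b + 1 by lra.
have K_gt0 : 0 < K.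
  have /andP[? _] : 0 < eta (b + 1) (eps / (b + 1)) <= 1.
    by apply: eta_map; rewrite // divr_gt0 //= ler_pdivrMr //; lra.
  by rewrite !mulr_gt0 //; lra.
have q_ge0 : 0 <= (b + 1) / K by rewrite ltW ?divr_gt0.
(* The integer part is at most [n] exactly when [(b + 1) / K < n + 1], hence the count of [n + 1]
   steps. *)
rewrite -ltnS truncn_lt_nat // ltr_pdivrMr // => bound.
rewrite leNgt; apply/negP => disp_gt.
have n_gt0 : 0 < n.+1%:R :> R by rewrite ltr0n.
(* The errors [3 * delta] of [n + 1] steps add up to the 1 in [b + 1]. *)
pose delta : R := (3 * n.+1%:R)^-1.
have delta_gt0 : 0 < delta by rewrite invr_gt0 mulr_gt0.
have ndelta : 3 * delta * n.+1%:R = 1.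
  by rewrite mulrAC mulfV // gt_eqF ?mulr_gt0.
have [y [Cy yx /ltW yTy]] := afp delta delta_gt0.
(* The first bound, from nonexpansivity and [yTy], makes [s = b + 1] admissible at every step; the
   second counts the losses [K] and is negative at [i = n + 1]. *)
suff decr i : (i <= n.+1)%N ->
    mdist (iter i T x) y <= b + delta * i%:R /\
    mdist (iter i T x) y <= b + 3 * delta * i%:R - K * i%:R.
  have [_ decr_n] := decr n.+1 (leqnn _).
  by have := mdist_ge0 (iter n.+1 T x) y; lra.
elim: i => [_|i IHi lt_in] /=; first by rewrite metric_sym; lra.
have [near_i decr_i] := IHi (ltnW lt_in).
have i_le : delta * i.+1%:R <= delta * n.+1%:R by rewrite ler_pM2l // ler_nat.
have Tne := ne _ _ (Ci i) Cy.
have Ttri := metric_triangle (T (iter i T x)) (T y) y.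
rewrite (metric_sym (T y)) in Ttri.
rewrite -natr1 !mulrDr !mulr1 in i_le *; split; first by lra.
have : mdist (T (iter i T x)) y <= mdist (iter i T x) y + 3 * delta - K.
  apply: (firmly_nonexpansive_dist_decrease _ _ _ _ hX C _ _ _ _ T) => //; try lra.
  by apply: le_trans (ltW disp_gt) (disp_mono i n lt_in).
lra.
Qed.
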